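(* Let $S$ be a square. Then there is a perfect Mondrian partition $\mathcal{P}(S)=\{R_1,R_2,\dots,R_7\}$ of $S$ into $7$ rectangles.
   Context: All rectangles have real side lengths. Two rectangles are congruent, written $R_1\cong R_2$, if the lengths of their sides (not necessarily in the same order) are equal. A $k$-partition ($k\ge 2$) of a rectangle $R$ is a tiling of $R$ by $k$ rectangles $R_1,\dots,R_k$. A partition $\{R_1,\dots,R_k\}$ of $R$ is a Mondrian partition if $R_i\not\cong R_j$ for all $i\ne j$. A Mondrian partition is perfect if $\mathrm{area}(R_i)=\frac1k\,\mathrm{area}(R)$ for every $i$. Squares are special cases of rectangles. *)

(* Defs.v *)
From HB Require Import structures.
From mathcomp Require Import all_boot all_order all_algebra.
From mathcomp Require Import all_classical all_reals all_analysis.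
Import Order.TTheory GRing.Theory Num.Theory numFieldNormedType.Exports.

Set Implicit Arguments.
Unset Strict Implicit.
Unset Printing Implicit Defensive.

Local Open Scope classical_set_scope.
Local Open Scope ring_scope.

(* A nondegenerate rectangle of the Euclidean plane, in arbitrary position:
   its sides have directions [dir] and [dir] rotated by a right angle. The same
   subset of the plane is presented by several records (one for each choice of
   the reference corner), so [width] and [height] are meaningful only up to
   exchange. *)
Record rectangle (R : realType) := Rectangle {
  corner : R * R;
  dir : R * R;
  width : R;
  height : R;
  dir_unit : dir.1 ^+ 2 + dir.2 ^+ 2 = 1;
  width_gt0 : 0 < width;
  height_gt0 : 0 < height }.

Definition region (R : realType) (Q : rectangle R) : set (R * R) :=
  [set ((corner Q).1 + s * (dir Q).1 - t * (dir Q).2,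
        (corner Q).2 + s * (dir Q).2 + t * (dir Q).1)
  | s in `[0, width Q] & t in `[0, height Q]].

Definition area (R : realType) (Q : rectangle R) : R := width Q * height Q.

Definition is_square (R : realType) (Q : rectangle R) : Prop :=
  width Q = height Q.

Definition congruent (R : realType) (Q1 Q2 : rectangle R) : Prop :=
  (width Q1 = width Q2 /\ height Q1 = height Q2) \/
  (width Q1 = height Q2 /\ height Q1 = width Q2).

Definition is_partition (R : realType) (k : nat) (Q : rectangle R)
    (P : 'I_k -> rectangle R) : Prop :=
  [/\ (2 <= k)%N,
      \bigcup_(i in [set: 'I_k]) region (P i) = region Q &
      forall i j : 'I_k, i != j ->
        interior (region (P i)) `&` interior (region (P j)) = set0].

Definition is_Mondrian (R : realType) (k : nat) (Q : rectangle R)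
    (P : 'I_k -> rectangle R) : Prop :=
  is_partition Q P /\
  forall i j : 'I_k, i != j -> ~ congruent (P i) (P j).

Definition is_perfect_Mondrian (R : realType) (k : nat) (Q : rectangle R)
    (P : 'I_k -> rectangle R) : Prop :=
  is_Mondrian Q P /\ forall i : 'I_k, area (P i) = k%:R^-1 * area Q.

(* Main.v *)
Require Import Defs.
From HB Require Import structures.
From mathcomp Require Import all_boot all_order all_algebra.
From mathcomp Require Import all_classical all_reals all_analysis.
From mathcomp Require Import ring lra.
Import Order.TTheory GRing.Theory Num.Theory numFieldNormedType.Exports.

(** The unit square has the following dissection into seven rectangles, with
    vertical cuts [x1 < x2 < x3] and horizontal cuts [y1 < y2 < y3]:

      - [0, x1] x [0, y2],  [x1, 1] x [0, y1],  [x1, x2] x [y1, y2],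
      - [x2, x3] x [y1, y3],  [x3, 1] x [y1, 1],
      - [0, x2] x [y2, y3],  [0, x3] x [y3, 1].

    When all areas are 1/7, elimination gives [x2 = 3/5] and
    [15 x1^2 - 16 x1 + 3 = 0]; with [s = sqrt 19], the root that fits yields

      - [x1 = (8 - s)/15],  [x2 = 3/5],  [x3 = (8 + s)/15],
      - [y1 = (7 - s)/14],  [y2 = (8 + s)/21],  [y3 = (13 + s)/21].

    Congruent rectangles have equal semiperimeters, and the semiperimeters of
    these seven rectangles are seven distinct affine functions of [s], whose
    values are told apart by [4.35 < s < 4.36] ([semiperimeter_neq]).

    The dissection is carried to a square in arbitrary position by its own
    orthonormal frame ([region_frame]). In that frame an interior point of a
    rectangle has coordinates strictly inside the bounds ([interior_frame]), so
    rectangles separated by a line parallel to a side have disjoint interiors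
    ([brick_partition]). *)

Set Implicit Arguments.
Unset Strict Implicit.
Unset Printing Implicit Defensive.

Local Open Scope classical_set_scope.
Local Open Scope ring_scope.

(** * The frame of a rectangle *)

Section Frame.
Variable R : realType.
Implicit Types (Q : rectangle R) (z : R * R).

(** Coordinates of a point along the two sides that meet at [corner Q]. *)
Definition xcoord Q z : R :=
  (z.1 - (corner Q).1) * (dir Q).1 + (z.2 - (corner Q).2) * (dir Q).2.

Definition ycoord Q z : R :=
  (z.2 - (corner Q).2) * (dir Q).1 - (z.1 - (corner Q).1) * (dir Q).2.

Lemma region_frame Q z :
  region Q z <-> 0 <= xcoord Q z <= width Q /\ 0 <= ycoord Q z <= height Q.
Proof.
have dE := dir_unit Q; rewrite /xcoord /ycoord; split=> [[s + [t + <-]]|[hx hy]].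
  rewrite /= !in_itv /= => hs ht.
  set x := (X in 0 <= X <= width Q); set y := (X in 0 <= X <= height Q).
  have -> : x = s * ((dir Q).1 ^+ 2 + (dir Q).2 ^+ 2) by rewrite /x; ring.
  have -> : y = t * ((dir Q).1 ^+ 2 + (dir Q).2 ^+ 2) by rewrite /y; ring.
  by rewrite dE !mulr1.
exists (xcoord Q z); first by rewrite /= in_itv.
exists (ycoord Q z); first by rewrite /= in_itv.
rewrite /xcoord /ycoord [RHS]surjective_pairing; congr pair.
  transitivity ((corner Q).1 +
      (z.1 - (corner Q).1) * ((dir Q).1 ^+ 2 + (dir Q).2 ^+ 2)); first by ring.
  by rewrite dE; ring.
transitivity ((corner Q).2 +
    (z.2 - (corner Q).2) * ((dir Q).1 ^+ 2 + (dir Q).2 ^+ 2)); first by ring.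
by rewrite dE; ring.
Qed.

(** A small enough translate of an interior point, in any direction, remains in
    the set. *)
Lemma interior_translate (A : set (R * R)) z p q : interior A z ->
  exists2 e : R, 0 < e & A (z.1 + e * p, z.2 + e * q).
Proof.
move=> Az.
have cvg_line : (fun e : R => (z.1 + e * p, z.2 + e * q)) @ (0 : R) --> z.
  have affine (c d : R) : (fun e : R => c + e * d) @ (0 : R) --> c.
    have {2}-> : c = c + 0 * d by rewrite mul0r addr0.
    by apply: cvgD; [exact: cvg_cst | apply: cvgMr_tmp; exact: cvg_id].
  by case: z {Az} => a b; exact: (cvg_pair (affine a p) (affine b q)).
have /nbhs_ballP[e /= e0 he] := cvg_line _ Az.
exists (e / 2); first by rewrite divr_gt0.
by apply: he; rewrite /ball /= sub0r normrN gtr0_norm; lra.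
Qed.

Lemma interior_frame Q z : interior (region Q) z ->
  0 < xcoord Q z < width Q /\ 0 < ycoord Q z < height Q.
Proof.
move=> Qz; have dE := dir_unit Q.
set p := (dir Q).1 in dE; set q := (dir Q).2 in dE.
have xcoordD e a b :
    xcoord Q (z.1 + e * a, z.2 + e * b) = xcoord Q z + e * (a * p + b * q).
  by rewrite /xcoord /= -/p -/q; ring.
have ycoordD e a b :
    ycoord Q (z.1 + e * a, z.2 + e * b) = ycoord Q z + e * (b * p - a * q).
  by rewrite /ycoord /= -/p -/q; ring.
(* Moving both ways along each side keeps the point in the region, hence makes
   the four bounds strict. *)
have [e1 e1_gt0 /region_frame[h1 _]] := interior_translate p q Qz.
have [e2 e2_gt0 /region_frame[h2 _]] := interior_translate (- p) (- q) Qz.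
have [e3 e3_gt0 /region_frame[_ h3]] := interior_translate (- q) p Qz.
have [e4 e4_gt0 /region_frame[_ h4]] := interior_translate q (- p) Qz.
move: h1 h2 h3 h4; rewrite !xcoordD !ycoordD.
have -> : p * p + q * q = 1 by rewrite -dE; ring.
have -> : - p * p + - q * q = - 1 by rewrite -dE; ring.
have -> : p * p - - q * q = 1 by rewrite -dE; ring.
have -> : - p * p - q * q = - 1 by rewrite -dE; ring.
by lra.
Qed.

(** * Subdividing a rectangle *)

(** The part of [Q] that corresponds to [[l, r] x [b, t]] when [Q] is
    identified with the unit square by its frame, rescaled along each side. *)
Definition brick Q (l r b t : R) (lr : l < r) (bt : b < t) : rectangle R :=
  @Rectangle R
    ((corner Q).1 + l * width Q * (dir Q).1 - b * height Q * (dir Q).2,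
     (corner Q).2 + l * width Q * (dir Q).2 + b * height Q * (dir Q).1)
    (dir Q) ((r - l) * width Q) ((t - b) * height Q) (dir_unit Q)
    (mulr_gt0 (etrans (subr_gt0 l r) lr) (width_gt0 Q))
    (mulr_gt0 (etrans (subr_gt0 b t) bt) (height_gt0 Q)).

Lemma area_brick Q l r b t (lr : l < r) (bt : b < t) :
  area (brick Q lr bt) = (r - l) * (t - b) * area Q.
Proof. by rewrite /area /=; ring. Qed.

Lemma xcoord_brick Q l r b t (lr : l < r) (bt : b < t) z :
  xcoord (brick Q lr bt) z = xcoord Q z - l * width Q.
Proof.
rewrite -[l * width Q]mulr1 -(dir_unit Q) /xcoord /=; ring.
Qed.

Lemma ycoord_brick Q l r b t (lr : l < r) (bt : b < t) z :
  ycoord (brick Q lr bt) z = ycoord Q z - b * height Q.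
Proof.
rewrite -[b * height Q]mulr1 -(dir_unit Q) /ycoord /=; ring.
Qed.

Lemma region_brick Q l r b t (lr : l < r) (bt : b < t) z :
  region (brick Q lr bt) z <->
  l <= xcoord Q z / width Q <= r /\ b <= ycoord Q z / height Q <= t.
Proof.
rewrite !ler_pdivlMr ?ler_pdivrMr ?width_gt0 ?height_gt0 //.
by apply: (iff_trans (region_frame _ _)); rewrite xcoord_brick ycoord_brick /=; lra.
Qed.

Lemma interior_brick Q l r b t (lr : l < r) (bt : b < t) z :
  interior (region (brick Q lr bt)) z ->
  l < xcoord Q z / width Q < r /\ b < ycoord Q z / height Q < t.
Proof.
move=> /interior_frame; rewrite xcoord_brick ycoord_brick /=.
rewrite !ltr_pdivlMr ?ltr_pdivrMr ?width_gt0 ?height_gt0 //.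
by lra.
Qed.

(** A dissection of the unit square, given by its bounds, transfers to any
    rectangle. *)
Lemma brick_partition k Q (l r b t : 'I_k -> R)
    (lr : forall i, l i < r i) (bt : forall i, b i < t i) :
  (2 <= k)%N ->
  (forall i, 0 <= l i /\ r i <= 1) -> (forall i, 0 <= b i /\ t i <= 1) ->
  (forall u v, 0 <= u <= 1 -> 0 <= v <= 1 ->
     exists i, l i <= u <= r i /\ b i <= v <= t i) ->
  (forall i j, i != j ->
     [\/ r i <= l j, r j <= l i, t i <= b j | t j <= b i]) ->
  is_partition Q (fun i => brick Q (lr i) (bt i)).
Proof.
move=> k2 lr01 bt01 cover sep.
have regionQ z : region Q z <->
    0 <= xcoord Q z / width Q <= 1 /\ 0 <= ycoord Q z / height Q <= 1.
  rewrite !ler_pdivlMr ?ler_pdivrMr ?width_gt0 ?height_gt0 //.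
  by rewrite !mul0r !mul1r; exact: region_frame.
split=> // [|i j ij].
  apply/seteqP; split=> z.
    move=> [i _ /region_brick hz]; apply/regionQ.
    by have := lr01 i; have := bt01 i; lra.
  move=> /regionQ[hu hv]; have [i hi] := cover _ _ hu hv.
  by exists i => //; apply/region_brick.
apply/seteqP; split=> // z [/interior_brick hi /interior_brick hj].
by case: (sep i j ij) => h; lra.
Qed.

Lemma congruent_semiperimeter Q1 Q2 :
  congruent Q1 Q2 -> width Q1 + height Q1 = width Q2 + height Q2.
Proof. by case=> -[-> ->] //; rewrite addrC. Qed.

End Frame.

(** * The dissection of the unit square *)

Section Dissection.
Variable R : realType.

(** Left, right, bottom and top bounds of the seven rectangles; [s] stands for
    the square root of 19. *)
Definition left_bound (s : R) (i : 'I_7) : R :=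
  nth 0 [:: 0; (8 - s) / 15; (8 - s) / 15; 3 / 5; (8 + s) / 15; 0; 0] i.

Definition right_bound (s : R) (i : 'I_7) : R :=
  nth 0 [:: (8 - s) / 15; 1; 3 / 5; (8 + s) / 15; 1; 3 / 5; (8 + s) / 15] i.

Definition bottom_bound (s : R) (i : 'I_7) : R :=
  nth 0 [:: 0; 0; (7 - s) / 14; (7 - s) / 14; (7 - s) / 14; (8 + s) / 21;
            (13 + s) / 21] i.

Definition top_bound (s : R) (i : 'I_7) : R :=
  nth 0 [:: (8 + s) / 21; (7 - s) / 14; (8 + s) / 21; (13 + s) / 21; 1;
            (13 + s) / 21; 1] i.

Variable s : R.
Hypotheses (s_sqr : s ^+ 2 = 19) (s_ge0 : 0 <= s).

Lemma sqrt19_bounds : 87 / 20 < s < 109 / 25.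
Proof.
by apply/andP; split; rewrite -(@ltr_pXn2r _ 2) ?nnegrE ?s_sqr //; lra.
Qed.

Let l := left_bound s.
Let r := right_bound s.
Let b := bottom_bound s.
Let t := top_bound s.

Ltac case7 i := case: i => -[|[|[|[|[|[|[|//]]]]]]] ?.

Lemma left_lt_right i : l i < r i.
Proof.
by have := sqrt19_bounds; case7 i; rewrite /l /r /left_bound /right_bound /=; lra.
Qed.

Lemma bottom_lt_top i : b i < t i.
Proof.
by have := sqrt19_bounds; case7 i; rewrite /b /t /bottom_bound /top_bound /=; lra.
Qed.

Lemma left_right01 i : 0 <= l i /\ r i <= 1.
Proof.
by have := sqrt19_bounds; case7 i; rewrite /l /r /left_bound /right_bound /=; lra.
Qed.

Lemma bottom_top01 i : 0 <= b i /\ t i <= 1.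
Proof.
by have := sqrt19_bounds; case7 i; rewrite /b /t /bottom_bound /top_bound /=; lra.
Qed.

Lemma dissection_cover u v : 0 <= u <= 1 -> 0 <= v <= 1 ->
  exists i, l i <= u <= r i /\ b i <= v <= t i.
Proof.
move=> hu hv; have hs := sqrt19_bounds.
have pick n (n7 : (n < 7)%N) : let i := Ordinal n7 in
    l i <= u <= r i /\ b i <= v <= t i ->
  exists i, l i <= u <= r i /\ b i <= v <= t i by move=> i ?; exists i.
rewrite /l /r /b /t /left_bound /right_bound /bottom_bound /top_bound in pick *.
have [v3|v3] := lerP ((13 + s) / 21) v.
  have [u3|u3] := lerP u ((8 + s) / 15).
    by apply: (pick 6) => //=; lra.
  by apply: (pick 4) => //=; lra.
have [u1|u1] := lerP u ((8 - s) / 15).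
  have [v2|v2] := lerP v ((8 + s) / 21).
    by apply: (pick 0) => //=; lra.
  by apply: (pick 5) => //=; lra.
have [v1|v1] := lerP v ((7 - s) / 14).
  by apply: (pick 1) => //=; lra.
have [u3|u3] := lerP ((8 + s) / 15) u.
  by apply: (pick 4) => //=; lra.
have [u2|u2] := lerP (3 / 5) u.
  by apply: (pick 3) => //=; lra.
have [v2|v2] := lerP v ((8 + s) / 21).
  by apply: (pick 2) => //=; lra.
by apply: (pick 5) => //=; lra.
Qed.

Lemma dissection_separated i j : i != j ->
  [\/ r i <= l j, r j <= l i, t i <= b j | t j <= b i].
Proof.
have hs := sqrt19_bounds; case7 i; case7 j => // _;
  rewrite /l /r /b /t /left_bound /right_bound /bottom_bound /top_bound /=;
  by [apply: Or41; lra | apply: Or42; lra | apply: Or43; lra | apply: Or44; lra].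
Qed.

Lemma dissection_area i : (r i - l i) * (t i - b i) = 7^-1.
Proof.
move: s_sqr; rewrite expr2 => hs; case7 i;
  rewrite /l /r /b /t /left_bound /right_bound /bottom_bound /top_bound /=; nra.
Qed.

Lemma semiperimeter_neq i j : i != j ->
  r i - l i + (t i - b i) != r j - l j + (t j - b j).
Proof.
have hs := sqrt19_bounds; case7 i; case7 j => // _; apply/eqP;
  rewrite /l /r /b /t /left_bound /right_bound /bottom_bound /top_bound /=; lra.
Qed.

End Dissection.

Theorem theorem2p1 (R : realType) (S : rectangle R) (hS : is_square S) :
  exists P : 'I_7 -> rectangle R, is_perfect_Mondrian S P.
Proof.
have s_sqr : Num.sqrt 19 ^+ 2 = 19 :> R by rewrite sqr_sqrtr.
have s_ge0 : 0 <= Num.sqrt 19 :> R by exact: sqrtr_ge0.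
exists (fun i => brick S (left_lt_right s_sqr s_ge0 i) (bottom_lt_top s_sqr s_ge0 i)).
split; last by move=> i; rewrite area_brick dissection_area.
split=> [|i j ij /congruent_semiperimeter /= /eqP].
  apply: brick_partition => //.
  - exact: left_right01.
  - exact: bottom_top01.
  - exact: dissection_cover.
  - exact: dissection_separated.
rewrite -hS -!mulrDl (inj_eq (mulIf (lt0r_neq0 (width_gt0 S)))).
exact/negP/semiperimeter_neq.
Qed.
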